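(* Let $A=\mathbb{F}_5[S_3]$ and $\sigma=\mathrm{id}_A$, so that $\mathcal{R}=A[z;\sigma]=A[z]$ is the ordinary polynomial ring. The minimal $(S_3,\mathrm{id}_A)$-convolutional codes $\mathcal{C}\subseteq\mathbb{F}_5[z]^6$ are the following. (i) Those with $\rho_\sigma(\mathcal{C})\subseteq Ag_1[z]$ are exactly two: the code of rank $1$ with basis $\{(1,1,1,1,1,1)\}$ and the code of rank $1$ with basis $\{(1,4,4,4,1,1)\}$; both are block codes. (ii) Those with $\rho_\sigma(\mathcal{C})\subseteq Ag_2[z]$ are the codes having as $\mathbb{F}_5[z]$-basis the two vectors $$(3a,\ 2a,\ 3c,\ 3a+2c,\ 2a+3c,\ 2c),\qquad (2c,\ 3a+2c,\ 2a,\ 3c,\ 3a,\ 2a+3c),$$ where $a,c\in\mathbb{F}_5[z]$ are arbitrary coprime polynomials (including the cases $a=0,\ c=1$ and $a=1,\ c=0$). Every such code has rank $2$ and complexity $\max\{2\deg a,\,2\deg c\}$ (with $\deg 0=-\infty$).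
   Context: $\mathbb{F}_5$ is the field with 5 elements; the elements of the symmetric group $S_3$ are enumerated as $b_1=I$, $b_2=(1\,2)$, $b_3=(1\,3)$, $b_4=(2\,3)$, $b_5=(1\,2\,3)$, $b_6=(1\,3\,2)$, and products of permutations are composed from right to left, e.g. $(1\,2)(2\,3)=(1\,2\,3)$. Put $g_1=2\bigl(I+(1\,2\,3)+(1\,3\,2)\bigr)$ and $g_2=I-g_1$; these are orthogonal central idempotents of $A$ and $A[z]=Ag_1[z]\oplus Ag_2[z]$, with $Ag_1\cong\mathbb{F}_5\oplus\mathbb{F}_5$ and $Ag_2\cong M_2(\mathbb{F}_5)$. A convolutional code of length $6$ is a direct summand $\mathcal{C}$ of the $\mathbb{F}_5[z]$-module $\mathbb{F}_5[z]^6$; its dimension $k$ is its rank. An encoder is a matrix whose $k$ rows form an $\mathbb{F}_5[z]$-basis of $\mathcal{C}$, and the complexity of $\mathcal{C}$ is the maximal degree of the $k\times k$ minors of an encoder. A block code is a convolutional code of complexity zero. The $\mathbb{F}_5[z]$-module isomorphism $\rho_\sigma:\mathbb{F}_5[z]^6\to A[z]$ sends $\sum_j z^j(w_{j1},\dots,w_{j6})$ (with $w_{ji}\in\mathbb{F}_5$) to $\sum_j z^j\sum_{i=1}^6 w_{ji}b_i$. A convolutional code $\mathcal{C}$ is an $(S_3,\mathrm{id}_A)$-convolutional code if $\rho_\sigma(\mathcal{C})$ is a left ideal of $A[z]$ that is a direct summand of $A[z]$ as a left $A[z]$-module; it is minimal if $\rho_\sigma(\mathcal{C})$ is indecomposable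 as a left $A[z]$-module. *)

(* Defs.v *)
From HB Require Import structures.
From mathcomp Require Import all_boot all_order all_algebra all_fingroup.
From mathcomp Require Import boolp classical_sets.
Set Implicit Arguments.
Unset Strict Implicit.
Unset Printing Implicit Defensive.
Import GRing.Theory.
Local Open Scope classical_set_scope.
Local Open Scope ring_scope.

Section Modules.
Variables (R : nzRingType) (V : lmodType R).
Implicit Types U W X : set V.

Definition submodule U : Prop := submod_closed (mem U).

(* X is the internal direct sum of U and W. *)
Definition is_dsum X U W : Prop :=
  X = [set u + w | u in U & w in W] /\ U `&` W = [set 0].

Definition direct_summand U : Prop :=
  submodule U /\ exists W, submodule W /\ is_dsum setT U W.

(* The zero module is not indecomposable. *)
Definition indecomposable U : Prop :=
  [/\ submodule U, U <> [set 0] &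
      forall U1 U2, submodule U1 -> submodule U2 -> is_dsum U U1 U2 ->
        U1 = [set 0] \/ U2 = [set 0]].

End Modules.

Section ConvolutionalCodes.
Variables (F : fieldType) (n : nat).
Implicit Type C : set 'rV[{poly F}]_n.

Definition conv_code C : Prop := direct_summand C.

Definition row_span k (G : 'M[{poly F}]_(k, n)) : set 'rV[{poly F}]_n :=
  [set u *m G | u in [set: 'rV[{poly F}]_k]].

(* The rows of G form an F[z]-basis of C. *)
Definition encoder k C (G : 'M[{poly F}]_(k, n)) : Prop :=
  C = row_span G /\ injective (fun u : 'rV[{poly F}]_k => u *m G).

Definition has_rank C (k : nat) : Prop :=
  exists G : 'M[{poly F}]_(k, n), encoder C G.

(* The zero polynomial gets degree 0 instead of -oo. This is harmless in a
   maximum of degrees of polynomials that are not all zero, such as the maximal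
   minors of an encoder, or two coprime polynomials. *)
Definition degree (p : {poly F}) : nat := (size p).-1.

(* An injective f selects k distinct columns; their order only affects the
   sign of the minor. *)
Definition max_minor_degree k (G : 'M[{poly F}]_(k, n)) : nat :=
  \max_(f : {ffun 'I_k -> 'I_n} | injectiveb f) degree (\det (colsub f G)).

Definition has_complexity C (d : nat) : Prop :=
  (exists k (G : 'M[{poly F}]_(k, n)), encoder C G) /\
  (forall k (G : 'M[{poly F}]_(k, n)), encoder C G -> max_minor_degree G = d).

Definition block_code C : Prop := conv_code C /\ has_complexity C 0.

End ConvolutionalCodes.

(* The group algebra F_5[S_3]; the regular module ('F_5)^o provides the scalar
   multiplication. *)
Definition A : Type := {ffun 'S_3 -> ('F_5)^o}.

HB.instance Definition _ := GRing.Lmodule.copy A {ffun 'S_3 -> ('F_5)^o}.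

Definition gelt (s : 'S_3) : A := [ffun t => (t == s)%:R].

(* In A permutations are composed from right to left, whereas (t * u)%g in
   MathComp applies t first: see gelt_mul below. *)
Definition A_mul (x y : A) : A :=
  [ffun s : 'S_3 => \sum_t x t * y (s * t^-1)%g].

Fact A_mulA : associative A_mul.
Proof.
move=> x y w; apply/ffunP=> s; rewrite !ffunE.
under eq_bigr => t _ do rewrite ffunE big_distrr /=.
under [RHS]eq_bigr => t _ do rewrite ffunE big_distrl /=.
rewrite [RHS]exchange_big /=; apply: eq_bigr => t _.
rewrite [RHS](reindex_inj (mulIg t)) /=; apply: eq_bigr => u _.
by rewrite mulrA mulgK invMg mulgA.
Qed.

Fact A_mul1l : left_id (gelt 1%g) A_mul.
Proof.
move=> x; apply/ffunP=> s; rewrite ffunE (bigD1 1%g) //= big1 => [|t /negPf nt].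
  by rewrite ffunE eqxx mul1r invg1 mulg1 addr0.
by rewrite ffunE nt mul0r.
Qed.

Fact A_mul1r : right_id (gelt 1%g) A_mul.
Proof.
move=> x; apply/ffunP=> s; rewrite ffunE (bigD1 s) //= big1 => [|t nt].
  by rewrite ffunE mulgV eqxx mulr1 addr0.
by rewrite ffunE -eq_mulgV1 eq_sym (negPf nt) mulr0.
Qed.

Fact A_mulDl : left_distributive A_mul +%R.
Proof.
move=> x y w; apply/ffunP=> s; rewrite !ffunE -big_split /=.
by apply: eq_bigr => t _; rewrite ffunE mulrDl.
Qed.

Fact A_mulDr : right_distributive A_mul +%R.
Proof.
move=> x y w; apply/ffunP=> s; rewrite !ffunE -big_split /=.
by apply: eq_bigr => t _; rewrite ffunE mulrDr.
Qed.

Fact A_one_neq0 : gelt 1%g != 0.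
Proof.
by apply/eqP=> /ffunP/(_ 1%g); rewrite !ffunE eqxx => /eqP; rewrite oner_eq0.
Qed.

HB.instance Definition _ := GRing.Zmodule_isNzRing.Build A
  A_mulA A_mul1l A_mul1r A_mulDl A_mulDr A_one_neq0.

Fact A_scaleAl (k : 'F_5) (x y : A) : k *: (x * y) = (k *: x) * y.
Proof.
apply/ffunP=> s; rewrite !ffunE scaler_sumr.
by apply: eq_bigr => t _; rewrite ffunE scalerAl.
Qed.

HB.instance Definition _ := GRing.Lmodule_isLalgebra.Build 'F_5 A A_scaleAl.

Fact A_scaleAr (k : 'F_5) (x y : A) : k *: (x * y) = x * (k *: y).
Proof.
apply/ffunP=> s; rewrite !ffunE scaler_sumr.
by apply: eq_bigr => t _; rewrite ffunE scalerAr.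
Qed.

HB.instance Definition _ := GRing.Lalgebra_isAlgebra.Build 'F_5 A A_scaleAr.

Lemma gelt_mul (s t : 'S_3) : gelt s * gelt t = gelt (t * s)%g.
Proof.
apply/ffunP=> u; rewrite ffunE (bigD1 s) //= big1 => [|v /negPf nv].
  by rewrite !ffunE eqxx mul1r addr0 (can2_eq (mulgKV s) (mulgK s)).
by rewrite ffunE nv mul0r.
Qed.

(* The points 1, 2, 3 are the elements 0, 1, 2 of 'I_3; perm (addrI 1) is the
   translation by 1 in Z/3, i.e. the cycle (1 2 3). *)
Definition cyc123 : 'S_3 := perm (@addrI 'I_3 1).

Lemma cyc123E : tperm 0 1 \o tperm 1 (2 : 'I_3) =1 cyc123.
Proof.
by move=> i; rewrite /= /cyc123 permE;
  case: i => [[|[|[]]]] //= lti; rewrite !permE /=; apply: val_inj.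
Qed.

Definition b : 'S_3 ^ 6 :=
  [ffun i : 'I_6 => nth 1%g
    [:: 1%g; tperm 0 1; tperm 0 2; tperm 1 2; cyc123; cyc123^-1%g] i].

Definition g1 : A := 2 *: (1 + gelt cyc123 + gelt cyc123^-1%g).
Definition g2 : A := 1 - g1.

(* The left ideal Ag[z] of A[z]. *)
Definition Agz (g : A) : set {poly A} :=
  [set p | forall j, exists x : A, p`_j = x * g].

Definition rho (v : 'rV[{poly 'F_5}]_6) : {poly A} :=
  \poly_(j < \max_i size (v 0%R i)) \sum_i (v 0 i)`_j *: gelt (b i).

Lemma coef_rho v j : (rho v)`_j = \sum_i (v 0 i)`_j *: gelt (b i).
Proof.
rewrite coef_poly; case: ltnP => // le_j; rewrite big1 // => i _.
rewrite nth_default ?scale0r //; apply: leq_trans le_j.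
exact: (leq_bigmax i).
Qed.

(* {poly A}^o is A[z] as a left module over itself; its submodules are the
   left ideals of A[z]. *)
Definition S3_code (C : set 'rV[{poly 'F_5}]_6) : Prop :=
  conv_code C /\ direct_summand (rho @` C : set {poly A}^o).

Definition minimal_S3_code (C : set 'rV[{poly 'F_5}]_6) : Prop :=
  S3_code C /\ indecomposable (rho @` C : set {poly A}^o).

Definition row6 (s : seq {poly 'F_5}) : 'rV[{poly 'F_5}]_6 := \row_(i < 6) s`_i.

Definition G_triv := row6 [:: 1; 1; 1; 1; 1; 1].
Definition G_sign := row6 [:: 1; 4; 4; 4; 1; 1].

Definition G_mat (a c : {poly 'F_5}) : 'M[{poly 'F_5}]_(2, 6) :=
  col_mx
    (row6 [:: 3 *: a; 2 *: a; 3 *: c; 3 *: a + 2 *: c; 2 *: a + 3 *: c; 2 *: c])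
    (row6 [:: 2 *: c; 3 *: a + 2 *: c; 2 *: a; 3 *: c; 3 *: a; 2 *: a + 3 *: c]).

(* Main.v *)
Require Import Defs.
From mathcomp Require Import all_boot all_order all_algebra all_fingroup.
From mathcomp Require Import boolp classical_sets.
From mathcomp Require Import ring.
Set Implicit Arguments.
Unset Strict Implicit.
Unset Printing Implicit Defensive.
Import GRing.Theory.
Local Open Scope classical_set_scope.
Local Open Scope ring_scope.

(** A left ideal of R = A[z] is a direct summand of R exactly when it is of the
form R f for an idempotent f (direct_summandP), and if R f is indecomposable
then f is primitive: the only idempotents e with e f = f e = e are 0 and f
(primitive_idempotent). So a central idempotent of R splits no minimal code
(central_idempotent_split). Applied to g1, this puts the code into A g1[z] or
into A g2[z]. Each of the two parts is then a ring that can be understood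
explicitly.

The element g1 is the sum of the idempotents e_triv and e_sign of the trivial
character and of the sign. For each of these, A e is the line spanned by e, so
A[z] e is a copy of F_5[z], where 0 and 1 are the only idempotents. Hence there
are exactly two codes in A g1[z], generated by e_triv and e_sign.

A g2 has a basis of matrix units E i j, so A g2[z] is isomorphic to the ring of
2 x 2 matrices over F_5[z] (Mx). A nonzero idempotent matrix other than 1 has
determinant 0 and trace 1, and by dividing a column by its gcd it is seen to be
z w with a column z and a row w such that w z = 1 (idempotent_mx2). The ideal
generated by z w consists of all v w with v a column (ideal_rank_one), and
rho identifies it with the code spanned by the rows of G_mat a c, where
w = (-a, c) (rho_G_mat); w z = 1 is a Bezout identity for a and c. Conversely,
such ideals are indecomposable because any two nonzero elements have a common
nonzero multiple (uniform_indecomposable); this argument also covers the lines.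

Two encoders of a code differ by an invertible matrix, so that their maximal
minors have the same degrees (encoder_has_complexity). The minors of G_mat a c
are quadratic forms in a and c, and a^2 and c^2 are linear combinations of
them (G_mat_max_minor_degree). *)

(** * Idempotents and indecomposable left ideals *)

Lemma submoduleP (R : nzRingType) (V : lmodType R) (U : set V) :
  submodule U <-> U 0 /\ forall a x y, U x -> U y -> U (a *: x + y).
Proof.
split=> [[U0 UD]|[U0 UD]]; split.
- by move: U0; rewrite in_setE.
- by move=> a x y Ux Uy; move: (UD a x y); rewrite !in_setE; apply.
- by rewrite in_setE.
- by move=> a x y; rewrite !in_setE; apply: UD.
Qed.

Section Idempotents.
Variable R : nzRingType.
Implicit Types (e f x : R) (U : set R^o).

(** For an idempotent f this is the left ideal R f. *)
Definition ideal_of f : set R^o := [set x : R^o | (x : R) * f = x].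

Lemma left_idealP U :
  submodule U <-> U 0 /\ forall (a x y : R), U x -> U y -> U (a * x + y).
Proof. exact: submoduleP. Qed.

Lemma submodule_ideal_of f : submodule (ideal_of f).
Proof.
apply/left_idealP; split=> [|a x y /= xf yf]; rewrite /ideal_of /=.
  by rewrite mul0r.
by rewrite mulrDl -mulrA xf yf.
Qed.

(** If 1 = f + g along R = U + W with f in U and g in W, then x g lies in both
    U and W for every x in U, so x = x f. Conversely R (1 - f) is a complement
    of R f. *)
Lemma direct_summandP U :
  direct_summand U <-> exists2 f : R, f * f = f & U = ideal_of f.
Proof.
split=> [[/left_idealP[U0 UD] [W [/left_idealP[W0 WD] [defT UW0]]]]|[f ff ->]].
  have: [set: R^o] (1 : R) by [].
  rewrite defT => -[f Uf [g Wg fg1]].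
  have UZ (a x : R) : U x -> U (a * x).
    by move=> Ux; rewrite -[_ * _]addr0; apply: UD.
  have WZ (a x : R) : W x -> W (a * x).
    by move=> Wx; rewrite -[_ * _]addr0; apply: WD.
  have xf (x : R) : U x -> x * f = x.
    move=> Ux; have: (U `&` W) (x * g).
      split; last exact: WZ.
      have -> : x * g = (- x) * f + x.
        by rewrite mulNr -[X in _ = _ + X]mulr1 -fg1 mulrDr addKr.
      exact: UD.
    rewrite UW0 /= => xg0.
    by rewrite -[RHS]mulr1 -fg1 mulrDr xg0 addr0.
  exists f; first exact: xf.
  apply/seteqP; split=> [x /= Ux|x /= <-]; [exact: xf | exact: UZ].
split; first exact: submodule_ideal_of.
exists (ideal_of (1 - f)); split; first exact: submodule_ideal_of.
split.
  apply/seteqP; split=> x // _; exists ((x : R) * f).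
    by rewrite /ideal_of /= -mulrA ff.
  exists ((x : R) * (1 - f)); last by rewrite -mulrDr addrC subrK mulr1.
  by rewrite /ideal_of /= -mulrA mulrBr mulr1 mulrBl mul1r ff subrr subr0.
apply/seteqP; split=> [x [/= xf]|x /= ->]; last first.
  by split; rewrite /ideal_of /= mul0r.
by rewrite /ideal_of /= mulrBr mulr1 xf subrr.
Qed.

(** The ideals R e and R (f - e) decompose R f. *)
Lemma primitive_idempotent f e :
  f * f = f -> indecomposable (ideal_of f) ->
  e * e = e -> e * f = e -> f * e = e -> e = 0 \/ e = f.
Proof.
move=> ff [_ _ indec] ee ef fe.
have ideal0 g : g * g = g -> ideal_of g = [set 0] -> g = 0.
  by move=> gg g0; have: ideal_of g g by []; rewrite g0.
have hh : (f - e) * (f - e) = f - e.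
  by rewrite mulrBr !mulrBl ff ef fe ee subrr subr0.
have [|||e0|h0] := indec (ideal_of e) (ideal_of (f - e)).
- exact: submodule_ideal_of.
- exact: submodule_ideal_of.
- split; apply/seteqP; split.
  + move=> x /= xf; exists ((x : R) * e); first by rewrite /ideal_of /= -mulrA ee.
    exists ((x : R) * (f - e)); first by rewrite /ideal_of /= -mulrA hh.
    by rewrite -mulrDr addrC subrK.
  + move=> _ [x xe [y ye <-]]; rewrite /ideal_of /= in xe ye *.
    rewrite mulrDl -{1}xe -{1}ye -!mulrA ef xe.
    by rewrite mulrBl ff ef ye.
  + move=> x [/= xe]; rewrite /ideal_of /= -{1}xe -mulrA mulrBr ef ee subrr.
    by rewrite mulr0.
  + by move=> x /= ->; split; rewrite /ideal_of /= mul0r.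
- by left; exact: ideal0 e0.
- by right; apply/eqP; rewrite eq_sym -subr_eq0; apply/eqP; exact: ideal0 h0.
Qed.

Lemma complement_idempotent e : e * e = e -> (1 - e) * (1 - e) = 1 - e.
Proof. by move=> ee; rewrite mulrBl mul1r mulrBr mulr1 ee subrr subr0. Qed.

(** The product f c is an idempotent below f. *)
Lemma central_idempotent_split f c :
  f * f = f -> indecomposable (ideal_of f) -> c * c = c -> (forall x, x * c = c * x) ->
  f * c = 0 \/ f * c = f.
Proof.
move=> ff indec cc comm; apply: primitive_idempotent => //.
- by rewrite mulrA -[f * c * f]mulrA -comm !mulrA ff -mulrA cc.
- by rewrite -mulrA -comm mulrA ff.
- by rewrite mulrA ff.
Qed.

Lemma ideal_of_sub f g : f * f = f -> (ideal_of f `<=` ideal_of g <-> f * g = f).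
Proof.
move=> ff; split=> [|fg x]; first by move/(_ f); apply.
by rewrite /ideal_of /= => <-; rewrite -mulrA fg.
Qed.

(** Summands intersect in 0, but nonzero elements of two summands would have a
    common nonzero multiple. *)
Lemma uniform_indecomposable U :
  submodule U -> U <> [set 0] ->
  (forall x y : R, U x -> U y -> x != 0 -> y != 0 ->
     exists a b : R, a * x = b * y /\ a * x != 0) ->
  indecomposable U.
Proof.
move=> modU U0 unifU; split=> // U1 U2 modU1 modU2 [defU U12].
have [/left_idealP[U1_0 U1D] /left_idealP[U2_0 U2D]] := (modU1, modU2).
apply: contrapT => /not_orP[nU1 nU2].
have nz W : W 0 -> W <> [set 0] -> exists2 x : R, W x & x != 0.
  move=> W0 nW; apply: contrapT => nx; apply: nW.
  apply/seteqP; split=> [x Wx /=|x /= -> //].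
  by apply: contrapT => /eqP x0; apply: nx; exists x.
have [[x U1x x0] [y U2y y0]] := (nz _ U1_0 nU1, nz _ U2_0 nU2).
have [||//|//|a [b [axby]]] := unifU x y.
- by rewrite defU; exists x => //; exists 0 => //; rewrite addr0.
- by rewrite defU; exists 0 => //; exists y => //; rewrite add0r.
have: (U1 `&` U2) (a * x).
  split; first by rewrite -[_ * _]addr0; apply: U1D.
  by rewrite axby -[_ * _]addr0; apply: U2D.
by rewrite U12 /= => ->; rewrite eqxx.
Qed.

End Idempotents.

(** * Idempotent 2 x 2 matrices over F[z] *)

Lemma sum2 (V : nmodType) (F : 'I_2 -> V) : \sum_i F i = F 0 + F 1.
Proof.
by rewrite !big_ord_recl big_ord0 addr0; congr (F _ + F _); apply: val_inj.
Qed.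

Lemma sum22 (F : fieldType) (V : lmodType F) (k : 'I_2 -> 'I_2 -> F) (e : 'I_2 -> 'I_2 -> V) :
  \sum_i \sum_j k i j *: e i j =
    k 0 0 *: e 0 0 + k 0 1 *: e 0 1 + (k 1 0 *: e 1 0 + k 1 1 *: e 1 1).
Proof. by rewrite 3!sum2. Qed.

Lemma ord2 (i : 'I_2) : i = 0 \/ i = 1.
Proof. by case: i => [[|[|i]] //= lt_i]; [left|right]; apply: val_inj. Qed.

Lemma det2 (R : comNzRingType) (M : 'M[R]_2) :
  \det M = M 0 0 * M 1 1 - M 0 1 * M 1 0.
Proof.
rewrite (expand_det_row _ 0) sum2 /cofactor !det_mx11 !mxE /= expr0 expr1 mul1r.
rewrite mulN1r mulrN; congr (_ * M _ _ - _ * M _ _); exact: val_inj.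
Qed.

Section PolyMatrices.
Variable F : fieldType.
Implicit Types p q : {poly F}.

Lemma coprimep_bezout p q : coprimep p q -> exists u v, u * p + v * q = 1.
Proof.
move/Bezout_coprimepP=> [[u v] /=]; rewrite -size_poly_eq1.
move/size_poly1P => [c c0 def_c]; exists (c^-1 *: u), (c^-1 *: v).
by rewrite -!scalerAl -scalerDr def_c -mul_polyC -polyCM mulVf.
Qed.

Lemma bezout_coprimep p q u v : u * p + v * q = 1 -> coprimep p q.
Proof. by move=> uv1; apply/Bezout_coprimepP; exists (u, v); rewrite uv1 eqpxx. Qed.

Definition row2 p q : 'rV[{poly F}]_2 := \row_j (if j == 0 then p else q).
Definition col2 p q : 'cV[{poly F}]_2 := \col_j (if j == 0 then p else q).

Lemma row2_col2 p q u v : row2 p q *m col2 u v = (p * u + q * v)%:M.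
Proof. by apply/matrixP=> i j; rewrite !ord1 !mxE sum2 !mxE /= mulr1n. Qed.

Lemma row2_eta (w : 'rV_2) : w = row2 (w 0 0) (w 0 1).
Proof.
by apply/rowP=> j; rewrite mxE; have [->|->] := ord2 j.
Qed.

(** A nonzero idempotent other than 1 has determinant 0; the entries of M M =
    M then give (tr M - 1) M = 0, so the trace is 1. With a zero first column
    the factorization is immediate. Otherwise d is the gcd of the first column
    and the column z is the first column divided by d; proportionality of the
    columns and a Bezout relation for z produce the second entry t of w, and w
    z = tr M = 1. *)
Lemma idempotent_mx2 (M : 'M[{poly F}]_2) :
  M *m M = M -> M != 0 -> M != 1%:M ->
  exists (z : 'cV_2) (w : 'rV_2), w *m z = 1%:M /\ M = z *m w.
Proof.
move=> MM M0 M1.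
have entry i j : M i 0 * M 0 j + M i 1 * M 1 j = M i j.
  by rewrite -[in RHS]MM mxE sum2.
have det0 : \det M = 0.
  apply/eqP; have /eqP : \det M * \det M = \det M by rewrite -det_mulmx MM.
  rewrite -subr_eq0 -{3}[\det M]mulr1 -mulrBr mulf_eq0 subr_eq0.
  case/orP=> // /eqP det1; case/eqP: M1.
  have unitM : M \in unitmx by rewrite unitmxE det1 unitr1.
  by rewrite -(mulVmx unitM) -{3}MM mulmxA mulVmx ?mul1mx.
have {det0} psqr : M 0 0 * M 1 1 = M 0 1 * M 1 0.
  by apply/eqP; rewrite -subr_eq0 -det2 det0.
have trM : M 0 0 + M 1 1 = 1.
  apply/eqP; rewrite -subr_eq0; apply: contraNT M0 => tr0.
  apply/eqP/matrixP=> i j; rewrite mxE; apply/eqP.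
  have /eqP : (M 0 0 + M 1 1 - 1) * M i j = 0.
    have := (entry 0 0, entry 0 1, entry 1 0, entry 1 1) => -[[[e00 e01] e10] e11].
    have [-> | ->] := ord2 i; have [-> | ->] := ord2 j.
    - by rewrite mulrBl mul1r -[X in _ - X]e00 mulrDl [M 1 1 * _]mulrC psqr subrr.
    - by rewrite mulrBl mul1r -[X in _ - X]e01 mulrDl [M 1 1 * _]mulrC subrr.
    - by rewrite mulrBl mul1r -[X in _ - X]e10 mulrDl [M 0 0 * _]mulrC subrr.
    - by rewrite mulrBl mul1r -[X in _ - X]e11 mulrDl psqr [M 0 1 * _]mulrC subrr.
  by rewrite mulf_eq0 (negPf tr0).
have mxM z0 z1 w0 w1 : M 0 0 = z0 * w0 -> M 0 1 = z0 * w1 ->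
    M 1 0 = z1 * w0 -> M 1 1 = z1 * w1 -> M = col2 z0 z1 *m row2 w0 w1.
  move=> e00 e01 e10 e11; apply/matrixP=> i j; rewrite mxE big_ord1 !mxE.
  by have [->|->] := ord2 i; have [->|->] := ord2 j.
have [/eqP[]|nz_col] := boolP ((M 0 0, M 1 0) == (0, 0)).
  move=> M00 M10; have M11 : M 1 1 = 1 by rewrite -trM M00 add0r.
  exists (col2 (M 0 1) 1), (row2 0 1); rewrite row2_col2 mul0r mul1r add0r.
  by split=> //; apply: mxM; rewrite ?M00 ?M10 ?M11 ?mulr0 ?mulr1.
set d := gcdp (M 0 0) (M 1 0).
have d0 : d != 0 by rewrite gcdp_eq0 -xpair_eqE.
have [def0 def1] : M 0 0 %/ d * d = M 0 0 /\ M 1 0 %/ d * d = M 1 0.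
  by split; apply: divpK; rewrite ?dvdp_gcdl ?dvdp_gcdr.
have cop : coprimep (M 0 0 %/ d) (M 1 0 %/ d).
  by apply: coprimep_div_gcd; rewrite -negb_and -xpair_eqE.
have [u [v uv1]] := coprimep_bezout cop.
move: (M 0 0 %/ d) (M 1 0 %/ d) def0 def1 uv1 {cop} => x y def0 def1 uv1.
have xs_qy : x * M 1 1 = M 0 1 * y.
  by apply: (mulIf d0); rewrite mulrAC def0 psqr -def1 mulrA.
pose t := u * M 0 1 + v * M 1 1.
have tx : x * t = M 0 1.
  by rewrite -[RHS]mul1r -uv1 /t mulrDr 2![x * _]mulrCA xs_qy; ring.
have ty : y * t = M 1 1.
  rewrite -[RHS]mul1r -uv1 /t mulrDr mulrCA [y * M 0 1]mulrC -xs_qy; ring.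
exists (col2 x y), (row2 d t); rewrite row2_col2; split.
  by rewrite mulrC def0 mulrC ty trM.
by apply: mxM.
Qed.

End PolyMatrices.

(** * Encoders and complexity *)

Section Encoders.
Variables (F : fieldType) (n : nat).

(** Each row of H is a combination of rows of G and conversely; U V = 1
    because the rows of H are independent. *)
Lemma encoder_change k k' (G : 'M[{poly F}]_(k, n)) (H : 'M_(k', n)) C :
  encoder C G -> encoder C H ->
  exists2 U : 'M_(k', k), H = U *m G & exists V : 'M_(k, k'), U *m V = 1%:M.
Proof.
have factor l l' (K : 'M[{poly F}]_(l, n)) (L : 'M_(l', n)) :
    row_span L `<=` row_span K -> exists U : 'M_(l', l), L = U *m K.
  move=> LK; have row_in i : exists u : 'rV_l, u *m K = row i L.
    have [|u _ <-] := LK (row i L); last by exists u.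
    by exists (delta_mx 0 i); rewrite // -rowE.
  have [u uP] := choice row_in; exists (\matrix_i u i).
  by apply/row_matrixP=> i; rewrite row_mul rowK uP.
move=> [-> _] [GH H_inj].
have [|U HUG] := factor _ _ G H; first by rewrite GH.
have [|V GVH] := factor _ _ H G; first by rewrite GH.
exists U => //; exists V; apply/row_matrixP=> i; apply: H_inj.
by rewrite /= -!row_mul -mulmxA -GVH -HUG mul1mx.
Qed.

(** A unit of F[z] is a nonzero constant. *)
Lemma degree_unitM (u v d : {poly F}) : u * v = 1 -> degree (u * d) = degree d.
Proof.
move=> uv1; have /eqP : size (u * v) = 1%N by rewrite uv1 size_poly1.
rewrite size_mul_eq1 => /andP[/size_poly1P[c c0 ->] _].
by rewrite /degree size_Cmul.
Qed.

(** Encoders of one code have equally many rows, and the maximal minors of U G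
    are those of G times the unit det U. *)
Lemma encoder_has_complexity k (G : 'M[{poly F}]_(k, n)) C :
  encoder C G -> has_complexity C (max_minor_degree G).
Proof.
move=> encG; split=> [|k' H encH]; first by exists k, G.
have [U HUG [V UV]] := encoder_change encG encH.
have [U' _ [V' UV']] := encoder_change encH encG.
have ek : k' = k.
  by apply/eqP; rewrite eqn_leq (mulmx1_min UV) (mulmx1_min UV').
subst k'.
apply: eq_bigr => f _.
have -> : colsub f H = U *m colsub f G.
  by apply/matrixP=> i j; rewrite HUG !mxE; apply: eq_bigr => l _; rewrite mxE.
by rewrite det_mulmx; apply: (@degree_unitM _ (\det V)); rewrite -det_mulmx UV det1.
Qed.

End Encoders.

(** * Multiplication of linear combinations in an algebra *)

Lemma span_comm (F : fieldType) (B : algType F) n (c : 'I_n -> F) (x : 'I_n -> B) y :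
  (forall i, x i * y = y * x i) ->
  (\sum_i c i *: x i) * y = y * (\sum_i c i *: x i).
Proof.
move=> xy; rewrite mulr_suml mulr_sumr; apply: eq_bigr => i _.
by rewrite -scalerAl -scalerAr xy.
Qed.

Lemma span_eigen (F : fieldType) (B : algType F) n (c k : 'I_n -> F) (x : 'I_n -> B) y :
  (forall i, x i * y = k i *: y) ->
  (\sum_i c i *: x i) * y = (\sum_i c i * k i) *: y.
Proof.
move=> xy; rewrite mulr_suml scaler_suml; apply: eq_bigr => i _.
by rewrite -scalerAl xy scalerA.
Qed.

Lemma span_table (F : fieldType) (B : algType F) n (c : 'I_n -> F) (x : 'I_n -> B) y
    m (k : 'I_n -> 'I_m -> 'I_m -> F) (e : 'I_m -> 'I_m -> B) :
  (forall i, x i * y = \sum_l \sum_j k i l j *: e l j) ->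
  (\sum_i c i *: x i) * y =
    \sum_l \sum_j (\matrix_(l, j) \sum_i c i * k i l j) l j *: e l j.
Proof.
move=> xy; rewrite mulr_suml.
under eq_bigr => i _ do rewrite -scalerAl xy scaler_sumr.
rewrite exchange_big; apply: eq_bigr => l _ /=.
under eq_bigr => i _ do rewrite scaler_sumr.
rewrite exchange_big; apply: eq_bigr => j _ /=.
by rewrite mxE scaler_suml; apply: eq_bigr => i _; rewrite scalerA.
Qed.

(** * Polynomials over an algebra with eigenvectors or matrix units *)

Section ScalarPolynomials.
Variables (F : fieldType) (B : algType F).
Local Notation emb := (map_poly (in_alg B)).

(** Coefficientwise, since the scalars of F are central in B. *)
Lemma emb_comm p (x : {poly B}) : emb p * x = x * emb p.
Proof.
apply/polyP=> j; rewrite coefM coefMr; apply: eq_bigr => i _.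
by rewrite coef_map /= mulr_algl mulr_algr.
Qed.

Lemma coef_embC p (x : B) j : (emb p * x%:P)`_j = p`_j *: x.
Proof. by rewrite coefMC coef_map /= mulr_algl. Qed.

Lemma embC k (x : B) : emb k%:P * x%:P = (k *: x)%:P.
Proof. by rewrite map_polyC -polyCM /= mulr_algl. Qed.

Lemma emb_oppC p (x : B) : emb p * (- x)%:P = emb (- p) * x%:P.
Proof. by rewrite polyCN rmorphN mulrN mulNr. Qed.

Lemma emb_mulDr p q r (x y : {poly B}) :
  emb p * (emb q * x + emb r * y) = emb (p * q) * x + emb (p * r) * y.
Proof. by rewrite mulrDr !mulrA -!rmorphM. Qed.

Lemma emb_inj (x : B) p q : x != 0 -> emb p * x%:P = emb q * x%:P -> p = q.
Proof.
move=> x0 eq_pq; apply/polyP=> j; have := coef_embC p x j.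
rewrite eq_pq coef_embC => /eqP.
by rewrite -subr_eq0 -scalerBl scaler_eq0 (negPf x0) orbF subr_eq0 => /eqP.
Qed.

Lemma polyC_comm (c : B) : (forall x, x * c = c * x) ->
  forall p : {poly B}, p * c%:P = c%:P * p.
Proof. by move=> cc p; apply/polyP=> j; rewrite coefMC coefCM. Qed.

Lemma polyC_mul_eq (x y c : B) : x * y = c -> x%:P * y%:P = c%:P.
Proof. by move=> <-; rewrite polyCM. Qed.

Lemma mul_polyC_compl f (c : B) : f * c%:P = 0 -> f * (1 - c)%:P = f.
Proof. by move=> fc; rewrite polyCB mulrBr fc subr0 mulr1. Qed.

Lemma mul_polyC_summand f (c d : B) : f * (c + d)%:P = f -> f * c%:P = 0 -> f * d%:P = f.
Proof. by rewrite polyCD mulrDr => fcd fc; rewrite fc add0r in fcd. Qed.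

(** An idempotent e such that B e is one-dimensional. In the application, e
    belongs to a linear character. *)
Section Line.
Variable e : B.
Hypotheses (ee : e * e = e) (e0 : e != 0).
Hypothesis eig : forall x, exists k : F, x * e = k *: e.

Lemma mul_line (x : {poly B}) : exists p, x * e%:P = emb p * e%:P.
Proof.
elim/poly_ind: x => [|x c [p IHp]]; first by exists 0; rewrite rmorph0 !mul0r.
have [k ck] := eig c; exists (p * 'X + k%:P).
rewrite mulrDl -mulrA -commr_polyX mulrA IHp -polyCM ck -embC.
by rewrite rmorphD rmorphM /= map_polyX mulrDl -!mulrA commr_polyX.
Qed.

Lemma ideal_line : ideal_of e%:P = [set emb p * e%:P | p in setT].
Proof.
apply/seteqP; split=> [x /= <-|_ [p _ <-]].
  by have [p ->] := mul_line x; exists p.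
by rewrite /ideal_of /= -mulrA (polyC_mul_eq ee).
Qed.

Lemma line_indecomposable : indecomposable (ideal_of e%:P).
Proof.
apply: uniform_indecomposable; first exact: submodule_ideal_of.
  move=> eq0; have: ideal_of e%:P e%:P by exact: polyC_mul_eq.
  by rewrite eq0 /= => /eqP; rewrite polyC_eq0 (negPf e0).
rewrite ideal_line => _ _ [p _ <-] [q _ <-] p0 q0; exists (emb q), (emb p).
split; first by rewrite !mulrA -!rmorphM mulrC.
rewrite mulrA -rmorphM; apply: contraNneq p0 => qp0.
have /emb_inj : emb (q * p) * e%:P = emb 0 * e%:P by rewrite qp0 rmorph0 mul0r.
move/(_ e0)/eqP; rewrite mulf_eq0 => /orP[/eqP q00|/eqP->].
  by rewrite q00 rmorph0 mul0r eqxx in q0.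
by rewrite rmorph0 mul0r.
Qed.

(** Write f = p e with a scalar polynomial p: then p^2 = p, and F[z] has no
    idempotents besides 0 and 1. *)
Lemma line_idempotent_unique f : f * f = f -> f * e%:P = f -> f != 0 -> f = e%:P.
Proof.
move=> ff fe f0; have [p def_f] := mul_line f; rewrite fe in def_f.
have pf : emb p * f = f.
  by rewrite -[RHS]ff [X in _ = _ * X]def_f mulrA -emb_comm -mulrA fe.
have pp : p * p = p by apply: (emb_inj e0); rewrite rmorphM -mulrA -def_f.
have p0 : p != 0 by apply: contraNneq f0 => p0; rewrite def_f p0 rmorph0 mul0r.
have -> : e%:P = emb 1 * e%:P by rewrite rmorph1 mul1r.
by rewrite def_f; congr (emb _ * _); apply: (mulfI p0); rewrite pp mulr1.
Qed.

End Line.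

Section MatrixUnits.
Variable E : 'I_2 -> 'I_2 -> B.
Hypotheses (E_mul : forall i j k l, E i j * E k l = (j == k)%:R *: E i l)
  (E0 : E 0 0 != 0).

(** The matrix ring over F[z] inside B[z], given by matrix units E of B. *)
Definition Mx (M : 'M[{poly F}]_2) : {poly B} :=
  \sum_i \sum_j emb (M i j) * (E i j)%:P.

Lemma MxD M N : Mx (M + N) = Mx M + Mx N.
Proof.
rewrite -big_split; apply: eq_bigr => i _; rewrite -big_split.
by apply: eq_bigr => j _; rewrite mxE rmorphD mulrDl.
Qed.

Lemma MxZ p M : Mx (p *: M) = emb p * Mx M.
Proof.
rewrite /Mx mulr_sumr; apply: eq_bigr => i _; rewrite mulr_sumr.
by apply: eq_bigr => j _; rewrite mxE rmorphM mulrA.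
Qed.

Lemma Mx0 : Mx 0 = 0.
Proof. by rewrite -(scale0r 0) MxZ rmorph0 mul0r. Qed.

Lemma E_Mx i j N : (E i j)%:P * Mx N = \sum_l emb (N j l) * (E i l)%:P.
Proof.
rewrite /Mx mulr_sumr (bigD1 j) //= [X in _ + X]big1 => [|k /negPf ne_kj]; last first.
  rewrite mulr_sumr big1 // => l _.
  by rewrite mulrA -emb_comm -mulrA -polyCM E_mul eq_sym ne_kj scale0r mulr0.
rewrite addr0 mulr_sumr; apply: eq_bigr => l _.
by rewrite mulrA -emb_comm -mulrA -polyCM E_mul eqxx scale1r.
Qed.

Lemma MxM M N : Mx (M *m N) = Mx M * Mx N.
Proof.
rewrite [Mx M]/Mx mulr_suml; apply: eq_bigr => i _; rewrite mulr_suml.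
under [RHS]eq_bigr => j _ do rewrite -mulrA E_Mx mulr_sumr.
rewrite exchange_big; apply: eq_bigr => l _ /=.
rewrite mxE rmorph_sum mulr_suml; apply: eq_bigr => j _.
by rewrite rmorphM mulrA.
Qed.

Lemma Mx1 : Mx 1%:M = (E 0 0 + E 1 1)%:P.
Proof.
rewrite /Mx !sum2 !mxE /= ?mulr1n ?mulr0n !rmorph0 !rmorph1 !mul0r !mul1r.
by rewrite addr0 add0r polyCD.
Qed.

(** Sandwiching between matrix units isolates an entry, which makes Mx
    injective. *)
Lemma Mx_entry M i j : (E 0 i)%:P * Mx M * (E j 0)%:P = emb (M i j) * (E 0 0)%:P.
Proof.
rewrite E_Mx mulr_suml (bigD1 j) //= big1 => [|l /negPf ne_lj].
  by rewrite -mulrA -polyCM E_mul eqxx scale1r addr0.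
by rewrite -mulrA -polyCM E_mul ne_lj scale0r mulr0.
Qed.

Lemma Mx_inj : injective Mx.
Proof.
move=> M N eqMN; apply/matrixP=> i j; apply: (emb_inj E0).
by rewrite -!Mx_entry eqMN.
Qed.

Lemma Mx_row2 a c (v : 'cV_2) : Mx (v *m row2 a c) =
  \sum_i (emb (v i 0 * a) * (E i 0)%:P + emb (v i 0 * c) * (E i 1)%:P).
Proof. by apply: eq_bigr => i _; rewrite sum2 !mxE !big_ord1 !mxE. Qed.

Lemma Mx_unit M : Mx M * (E 0 0 + E 1 1)%:P = Mx M.
Proof. by rewrite -Mx1 -MxM mulmx1. Qed.

Hypothesis E_span : forall x, exists K : 'M[F]_2,
  x * (E 0 0 + E 1 1) = \sum_i \sum_j K i j *: E i j.

(** The matrix units span B (E 0 0 + E 1 1), hence, coefficient by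
    coefficient, its polynomials. *)
Lemma Mx_surj (x : {poly B}) : exists M, x * (E 0 0 + E 1 1)%:P = Mx M.
Proof.
elim/poly_ind: x => [|x c [M IHM]]; first by exists 0; rewrite mul0r Mx0.
have [K cK] := E_span c; exists ('X *: M + map_mx polyC K).
rewrite MxD MxZ map_polyX mulrDl -mulrA -commr_polyX mulrA IHM commr_polyX.
congr (_ + _); rewrite -polyCM cK rmorph_sum; apply: eq_bigr => i _.
by rewrite rmorph_sum; apply: eq_bigr => j _; rewrite mxE embC.
Qed.

Section RankOne.
Variables (w : 'rV[{poly F}]_2) (z : 'cV[{poly F}]_2).
Hypothesis wz : w *m z = 1%:M.

Lemma rank_one_idempotent : Mx (z *m w) * Mx (z *m w) = Mx (z *m w).
Proof. by rewrite -MxM mulmxA -(mulmxA z w z) wz mulmx1. Qed.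

(** If x = M z w then x = v w with v = M z, and conversely v w (z w) = v w. *)
Lemma ideal_rank_one : ideal_of (Mx (z *m w)) = [set Mx (v *m w) | v in setT].
Proof.
apply/seteqP; split=> [x /= <-|_ [v _ <-]].
  have [M xM] := Mx_surj x; exists (M *m z) => //.
  by rewrite -mulmxA MxM -xM -Mx1 -mulrA -MxM mul1mx.
by rewrite /ideal_of /= -MxM mulmxA -(mulmxA v w z) wz mulmx1.
Qed.

(** For nonzero columns v and v', matrices with a single nonzero entry take v
    and v' to the same multiple (v i 0 * v' j 0) of the first unit column,
    which is nonzero because F[z] is a domain. So the ideal is uniform. *)
Lemma rank_one_indecomposable : indecomposable (ideal_of (Mx (z *m w))).
Proof.
have Mxw0 v : Mx (v *m w) = 0 -> v = 0.
  move=> vw0; have: v *m w = 0 by apply: Mx_inj; rewrite Mx0.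
  by move/(congr1 (mulmx^~ z)); rewrite -mulmxA wz mulmx1 mul0mx.
have nzE (v : 'cV[{poly F}]_2) : Mx (v *m w) != 0 -> exists i, v i 0 != 0.
  move=> nz; apply: contrapT => v0; case/eqP: nz.
  have -> : v = 0.
    apply/colP=> i; rewrite mxE; apply/eqP/negPn/negP => vi0.
    by apply: v0; exists i.
  by rewrite mul0mx Mx0.
apply: uniform_indecomposable; first exact: submodule_ideal_of.
  move=> eq0; have: ideal_of (Mx (z *m w)) (Mx (z *m w)).
    exact: rank_one_idempotent.
  rewrite eq0 /= => /Mxw0 z0; have := wz; rewrite z0 mulmx0 => /matrixP/(_ 0 0).
  by rewrite !mxE => /eqP; rewrite eq_sym oner_eq0.
rewrite ideal_rank_one => _ _ [v _ <-] [v' _ <-] /nzE[i vi0] /nzE[j v'j0].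
have delta_mul (k : 'I_2) (x : 'cV[{poly F}]_2) :
    delta_mx 0 k *m x = x k 0 *: delta_mx 0 0 :> 'cV_2.
  apply/colP=> l; rewrite !mxE (bigD1 k) //= big1 => [|m /negPf ne_mk].
    by rewrite !mxE !eqxx !andbT addr0 mulrC.
  by rewrite !mxE ne_mk andbF mul0r.
exists (Mx (v' j 0 *: delta_mx 0 i)), (Mx (v i 0 *: delta_mx 0 j)).
rewrite -!MxM !mulmxA -!scalemxAl !delta_mul -!scalemxAl !scalerA mulrC; split=> //.
apply/eqP; rewrite scalemxAl => /Mxw0/colP/(_ 0)/eqP.
by rewrite !mxE eqxx mulr1 mulf_eq0 (negPf vi0) (negPf v'j0).
Qed.

End RankOne.

(** The matrix of f is not 1: otherwise E 0 0 would be an idempotent below f,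
    contradicting primitivity. So idempotent_mx2 applies. *)
Lemma rank_one_of_indecomposable f :
  f * f = f -> f * (E 0 0 + E 1 1)%:P = f -> indecomposable (ideal_of f) ->
  exists (z : 'cV_2) (w : 'rV_2), w *m z = 1%:M /\ f = Mx (z *m w).
Proof.
move=> ff fg indec; have [M fM] := Mx_surj f; rewrite fg in fM.
have [||| z [w [wz Mzw]]] := @idempotent_mx2 F M.
- by apply: Mx_inj; rewrite MxM -fM ff.
- apply/eqP=> M0; case: indec => _ [] ; apply/seteqP; split=> x /=.
    by rewrite /ideal_of /= fM M0 Mx0 mulr0.
  by move=> ->; rewrite /ideal_of /= mul0r.
- apply/eqP=> M1; have f1 : f = (E 0 0 + E 1 1)%:P by rewrite fM M1 Mx1.
  have E01 : E 0 0 * E 1 1 = 0 by rewrite E_mul scale0r.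
  have E10 : E 1 1 * E 0 0 = 0 by rewrite E_mul scale0r.
  have [|||/eqP|] := primitive_idempotent ff indec (e := (E 0 0)%:P).
  + by rewrite -polyCM E_mul scale1r.
  + by rewrite f1 -polyCM mulrDr E01 addr0 E_mul scale1r.
  + by rewrite f1 -polyCM mulrDl E10 addr0 E_mul scale1r.
  + by rewrite polyC_eq0 (negPf E0).
  rewrite f1 => /polyC_inj; rewrite -{1}[E 0 0]addr0 => /addrI E11.
  have: E 0 1 * E 1 1 * E 1 0 = E 0 0 by rewrite !E_mul !scale1r E_mul scale1r.
  by rewrite -E11 mulr0 mul0r => /eqP; rewrite eq_sym (negPf E0).
by exists z, w; split=> //; rewrite fM Mzw.
Qed.

End MatrixUnits.
End ScalarPolynomials.

(** * The minors of G_mat *)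

Definition coef_row (s : seq nat) (p : {poly 'F_5}) : 'rV[{poly 'F_5}]_6 :=
  \row_i ((nth 0%N s i)%:R *: p).

(** Row i of G_mat a c has coefficients Gc i 0 for a and Gc i 1 for c. *)
Definition G_coef : seq (seq (seq nat)) :=
  [:: [:: [:: 3; 2; 0; 3; 2; 0]; [:: 0; 0; 3; 2; 3; 2]];
      [:: [:: 0; 3; 2; 0; 3; 2]; [:: 2; 2; 0; 3; 0; 3]]]%N.

Definition Gc (i j : nat) : seq nat := nth [::] (nth [::] G_coef i) j.

Lemma row_G_mat a c (i : 'I_2) :
  row i (G_mat a c) = coef_row (Gc i 0) a + coef_row (Gc i 1) c.
Proof.
have [->|->] := ord2 i.
  have -> : 0 = lshift 1 0 :> 'I_(1 + 1) by apply: val_inj.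
  rewrite [LHS](@rowKu _ 1 1); apply/rowP=> j; rewrite !mxE.
  case: j => [[|[|[|[|[|[|j]]]]]] //= lt_j]; rewrite ?scale0r ?addr0 ?add0r //.
have -> : 1 = rshift 1 0 :> 'I_(1 + 1) by apply: val_inj.
rewrite [LHS](@rowKd _ 1 1); apply/rowP=> j; rewrite !mxE.
case: j => [[|[|[|[|[|[|j]]]]]] //= lt_j]; rewrite ?scale0r ?addr0 ?add0r //.
Qed.

Lemma G_mat_entry a c i j : G_mat a c i j =
  (nth 0%N (Gc i 0) j)%:R * a + (nth 0%N (Gc i 1) j)%:R * c.
Proof.
have /rowP/(_ j) := row_G_mat a c i; rewrite !mxE => ->.
by rewrite !scaler_nat !mulr_natl.
Qed.

Lemma poly_F5_char : 5%:R = 0 :> {poly 'F_5}.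
Proof.
have -> : 5%:R = (5%:R : 'F_5)%:P by rewrite rmorph_nat.
by rewrite -polyC0; congr _%:P; apply: val_inj.
Qed.

Lemma minor2 (R : comNzRingType) n (G : 'M[R]_(2, n)) (f : 'I_2 -> 'I_n) :
  \det (colsub f G) = G 0 (f 0) * G 1 (f 1) - G 0 (f 1) * G 1 (f 0).
Proof. by rewrite det2 !mxE. Qed.

(** All 2 x 2 minors are quadratic forms in a and c, which bounds their
    degrees from above. Conversely, a^2 and c^2 are linear combinations of the
    minors on the columns 0 and 1, 0 and 2, 0 and 5, so some minor reaches
    each of their degrees. *)
Lemma G_mat_max_minor_degree a c : coprimep a c ->
  max_minor_degree (G_mat a c) = maxn (2 * degree a) (2 * degree c).
Proof.
move=> cop; apply/eqP; rewrite eqn_leq; apply/andP; split.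
  apply/bigmax_leqP => f _; rewrite /degree minor2.
  set s := maxn (size a) (size c).
  have s_gt0 : (0 < s)%N.
    rewrite leq_max !size_poly_gt0 -negb_and; apply: contraTN cop.
    by move=> /andP[/eqP-> /eqP->]; rewrite /coprimep gcdp0 size_poly0.
  have entry i j : (size (G_mat a c i j) <= s)%N.
    rewrite G_mat_entry !mulr_natl -!scaler_nat.
    apply: leq_trans (size_polyD _ _) _; rewrite geq_max.
    by rewrite !(leq_trans (size_scale_leq _ _)) ?leq_maxl ?leq_maxr.
  have prod i j k l : (size (G_mat a c i j * G_mat a c k l)%R <= (s + s).-1)%N.
    apply: leq_trans (size_polyMleq _ _) _.
    by rewrite -!subn1 leq_sub2r // leq_add.
  have : (size (G_mat a c 0 (f 0) * G_mat a c 1 (f 1) -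
     G_mat a c 0 (f 1) * G_mat a c 1 (f 0))%R <= (s + s).-1)%N.
    by apply: leq_trans (size_polyD _ _) _; rewrite size_polyN geq_max !prod.
  rewrite -maxnMr => le_s.
  have -> : maxn (size a).-1 (size c).-1 = s.-1.
    by rewrite /s; case: (size a) (size c) => [|x] [|y]; rewrite ?maxnSS ?max0n ?maxn0.
  case: s s_gt0 le_s {entry prod} => // s _; rewrite addSn addnS /= mul2n -addnn => le_s.
  by rewrite -subn1 leq_subLR add1n.
set D := max_minor_degree _.
have minor (j k : 'I_6) : j != k ->
    (size (G_mat a c 0 j * G_mat a c 1 k - G_mat a c 0 k * G_mat a c 1 j)%R <= D.+1)%N.
  move=> ne_jk; pose f := [ffun i : 'I_2 => if i == 0 then j else k].
  have inj_f : injectiveb f.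
    apply/injectiveP=> x y; rewrite !ffunE.
    have [->|->] := ord2 x; have [->|->] := ord2 y => //= /eqP.
      by rewrite (negPf ne_jk).
    by rewrite eq_sym (negPf ne_jk).
  have le_D : (degree (\det (colsub f (G_mat a c))) <= D)%N.
    exact: (leq_bigmax_cond (P := fun f : {ffun _ -> _} => injectiveb f)).
  rewrite minor2 !ffunE /= in le_D.
  by apply: leq_trans (leqSpred _) _; rewrite ltnS.
have sizeD (x y : {poly 'F_5}) : (size x <= D.+1)%N -> (size y <= D.+1)%N -> (size (x + y)%R <= D.+1)%N.
  by move=> hx hy; apply: leq_trans (size_polyD _ _) _; rewrite geq_max hx hy.
have sizeN (x : {poly 'F_5}) : (size x <= D.+1)%N -> (size (- x)%R <= D.+1)%N by rewrite size_polyN.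
pose o k : 'I_6 := inord k.
have := (minor (o 0) (o 1), minor (o 0) (o 2), minor (o 0) (o 5))%N => -[[]].
rewrite -!val_eqE !G_mat_entry /= !inordK // /Gc /=.
set m01 := (X in (size (polyseq X) <= _)%N); move=> /(_ isT) s01.
set m02 := (X in (size (polyseq X) <= _)%N); move=> /(_ isT) s02.
set m05 := (X in (size (polyseq X) <= _)%N); move=> /(_ isT) s05.
(* The two sides agree over the integers up to a multiple of 5. *)
have aa : a * a = m01 + m01 - m05 - m02.
  transitivity (m01 + m01 - m05 - m02 - 5%:R * (a * a - a * c + 2%:R * c * c)).
    by rewrite /m01 /m02 /m05; ring.
  by rewrite poly_F5_char mul0r subr0.
have cc : c * c = a * a - m02.
  transitivity (a * a - m02 + 5%:R * (a * a - c * c)).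
    by rewrite /m02; ring.
  by rewrite poly_F5_char mul0r addr0.
have saa : (size (a * a)%R <= D.+1)%N.
  rewrite aa; exact: sizeD _ _ (sizeD _ _ (sizeD _ _ s01 s01) (sizeN _ s05)) (sizeN _ s02).
have scc : (size (c * c)%R <= D.+1)%N.
  rewrite cc; exact: sizeD _ _ saa (sizeN _ s02).
have sq (p : {poly 'F_5}) : (size (p * p)%R <= D.+1)%N -> (2 * degree p <= D)%N.
  by move=> sp; rewrite mulnC -size_exp expr2 -subn1 leq_subLR add1n.
by rewrite geq_max !sq.
Qed.

(** * Explicit computation in A *)

Definition b_images : seq (seq nat) :=
  [:: [:: 0; 1; 2]; [:: 1; 0; 2]; [:: 2; 1; 0];
      [:: 0; 2; 1]; [:: 1; 2; 0]; [:: 2; 0; 1]]%N.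

Definition b_image (i k : nat) := nth 0%N (nth [::] b_images i) k.

Lemma bE (i : 'I_6) (k : 'I_3) : b i k = b_image i k :> nat.
Proof.
have cycV (j l : 'I_3) : cyc123 l = j -> (cyc123^-1)%g j = l.
  by move=> <-; rewrite permK.
rewrite ffunE; case: i => [[|[|[|[|[|[|i]]]]]] //= _];
  case: k => [[|[|[|k]]] //= lt_k]; try by rewrite ?permE.
- by rewrite (cycV _ 2) // permE; apply: val_inj.
- by rewrite (cycV _ 0) // permE; apply: val_inj.
- by rewrite (cycV _ 1) // permE; apply: val_inj.
Qed.

Lemma b_eq (i : 'I_6) (s : 'S_3) :
  (forall k, s k = b_image i k :> nat) -> s = b i.
Proof. by move=> eq_s; apply/permP=> k; apply: val_inj; rewrite /= eq_s bE. Qed.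

Lemma b_inj : injective b.
Proof.
move=> i j eq_ij.
have eq_im (k : 'I_3) : b_image i k == b_image j k by rewrite -!bE eq_ij.
apply: val_inj; move: {eq_im eq_ij} (eq_im 0) (eq_im 1); move: i j.
by case=> [[|[|[|[|[|[|i]]]]]] //= _]; case=> [[|[|[|[|[|[|j]]]]]] //= _].
Qed.

Lemma b_bij : bijective b.
Proof. by apply: inj_card_bij b_inj _; rewrite card_Sn card_ord. Qed.

(** Entry j of list i is the index of b i b j, composed from right to left. *)
Definition btab : seq (seq nat) :=
  [:: [:: 0; 1; 2; 3; 4; 5]; [:: 1; 0; 5; 4; 3; 2]; [:: 2; 4; 0; 5; 1; 3];
      [:: 3; 5; 4; 0; 2; 1]; [:: 4; 2; 3; 1; 5; 0]; [:: 5; 3; 1; 2; 0; 4]]%N.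

Definition bmul (i j : nat) := nth 0%N (nth [::] btab i) j.

Lemma gelt_b_mul (i j k : 'I_6) : bmul i j = k ->
  gelt (b i) * gelt (b j) = gelt (b k).
Proof.
move=> eq_k; rewrite gelt_mul; congr gelt; apply: b_eq => l.
rewrite permM bE bE -eq_k.
by move: l; case: i {eq_k} => [[|[|[|[|[|[|i]]]]]] //= _];
  case: j => [[|[|[|[|[|[|j]]]]]] //= _]; case=> [[|[|[|l]]]].
Qed.

(** Elements of A with explicit coordinates in the basis b_1, ..., b_6, given
    by natural numbers read modulo 5. Sums, multiples and products of such
    elements are computed on the coordinate lists, so that identities in A
    reduce to el_eq and an evaluation in nat. *)
Definition el (s : seq nat) : A := \sum_(i < 6) (nth 0%N s i)%:R *: gelt (b i).

Lemma el_eq s t :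
  all (fun i => nth 0 s i %% 5 == nth 0 t i %% 5)%N (iota 0 6) -> el s = el t.
Proof.
move/allP=> eq_st; apply: eq_bigr => i _; congr (_ *: _).
apply: val_inj; rewrite /= !val_Fp_nat //.
by apply/eqP/eq_st; rewrite mem_iota ltn_ord.
Qed.

Lemma elD s t :
  el s + el t = el (mkseq (fun i => nth 0 s i + nth 0 t i) 6)%N.
Proof.
rewrite -big_split; apply: eq_bigr => i _.
by rewrite nth_mkseq ?ltn_ord // natrD scalerDl.
Qed.

Lemma elZ n s : n%:R *: el s = el (mkseq (fun i => n * nth 0 s i) 6)%N.
Proof.
rewrite scaler_sumr; apply: eq_bigr => i _.
rewrite nth_mkseq; [rewrite natrM -scalerA; reflexivity | exact: ltn_ord].
Qed.

Lemma el_unit (i : 'I_6) : gelt (b i) = el (mkseq (fun j => nat_of_bool (j == i)) 6).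
Proof.
rewrite /el (bigD1 i) // big1 => [|j /negPf ne_ji]; rewrite nth_mkseq ?ltn_ord //.
  by rewrite eqxx scale1r /= addr0.
by rewrite val_eqE ne_ji scale0r.
Qed.

(** Coordinate k of a product, by the multiplication table. *)
Definition conv6 s t k : nat :=
  sumn [seq sumn [seq (if bmul i j == k then nth 0 s i * nth 0 t j else 0)%N
                 | j <- iota 0 6] | i <- iota 0 6].

Lemma elM s t : el s * el t = el (mkseq (conv6 s t) 6).
Proof.
have sumE (F : nat -> nat) : sumn [seq F i | i <- iota 0 6] = \sum_(i < 6) F i.
  by rewrite sumnE big_map -(big_mkord xpredT F).
have bmul_lt (i j : 'I_6) : (bmul i j < 6)%N.
  by case: i => [[|[|[|[|[|[|i]]]]]] //= _]; case: j => [[|[|[|[|[|[|j]]]]]]].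
transitivity (\sum_(k < 6) \sum_(i < 6) \sum_(j < 6)
    (if bmul i j == k then nth 0 s i * nth 0 t j else 0)%N%:R *: gelt (b k)).
  rewrite mulr_suml exchange_big; apply: eq_bigr => i _ /=.
  rewrite mulr_sumr exchange_big; apply: eq_bigr => j _ /=.
  rewrite -scalerAl -scalerAr scalerA -natrM.
  rewrite (gelt_b_mul (k := Ordinal (bmul_lt i j))) //.
  rewrite (bigD1 (Ordinal (bmul_lt i j))) //= eqxx big1 ?addr0 // => k.
  by rewrite -val_eqE eq_sym /= => /negPf->; rewrite scale0r.
apply: eq_bigr => k _; rewrite nth_mkseq ?ltn_ord //.
rewrite /conv6 sumE natr_sum scaler_suml; apply: eq_bigr => i _.
by rewrite sumE natr_sum scaler_suml.
Qed.

Lemma scaleAE k (x : A) s : (k *: x) s = k * x s.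
Proof. by rewrite ffunE. Qed.

Lemma gelt_b (i j : 'I_6) : gelt (b i) (b j) = (i == j)%:R.
Proof. by rewrite [gelt _ _]ffunE (inj_eq b_inj) eq_sym. Qed.

Definition coord (x : A) (i : 'I_6) : 'F_5 := x (b i).

Lemma coord0 i : coord 0 i = 0.
Proof. by rewrite /coord ffunE. Qed.

Lemma coord_sum (c : 'I_6 -> 'F_5) j : coord (\sum_i c i *: gelt (b i)) j = c j.
Proof.
rewrite /coord sum_ffunE (bigD1 j) //= big1 => [|i /negPf ne_ij].
  by rewrite scaleAE gelt_b eqxx mulr1 addr0.
by rewrite scaleAE gelt_b ne_ij mulr0.
Qed.

Lemma el_neq0 s : (nth 0 s 0 %% 5 != 0)%N -> el s != 0.
Proof.
apply: contraNneq => /(congr1 (coord^~ 0)) /eqP.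
by rewrite coord_sum coord0 -val_eqE /= val_Fp_nat.
Qed.

Lemma coordK (x : A) : \sum_(i < 6) coord x i *: gelt (b i) = x.
Proof.
have [b' _ b'K] := b_bij.
apply/ffunP=> s; rewrite -(b'K s).
exact: (coord_sum (coord x)).
Qed.

Lemma g1E : g1 = el [:: 2; 0; 0; 0; 2; 2]%N.
Proof.
rewrite /g1.
have -> : 1 = gelt (b 0) by rewrite ffunE.
have -> : gelt cyc123 = gelt (b (Ordinal (isT : (4 < 6)%N))) by rewrite ffunE.
have -> : gelt cyc123^-1 = gelt (b (Ordinal (isT : (5 < 6)%N))) by rewrite ffunE.
by rewrite !el_unit !elD (elZ 2) //; apply: el_eq.
Qed.

Lemma el1 : 1 = el [:: 1]%N.
Proof.
have -> : 1 = gelt (b 0) by rewrite ffunE.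
by rewrite el_unit; apply: el_eq.
Qed.

Lemma g2E : g2 = el [:: 4; 0; 0; 0; 3; 3]%N.
Proof.
apply/eqP; rewrite /g2 subr_eq g1E elD el1; apply/eqP.
exact: el_eq.
Qed.

(** * The coordinate map and the decomposition of A *)

Local Notation emb := (map_poly (in_alg A)).

Lemma rhoE v : rho v = \sum_i emb (v 0 i) * (gelt (b i))%:P.
Proof.
apply/polyP=> j; rewrite coef_rho coef_sum.
by apply: eq_bigr => i _; rewrite coef_embC.
Qed.

Lemma rhoD v w : rho (v + w) = rho v + rho w.
Proof.
rewrite !rhoE -big_split; apply: eq_bigr => i _ /=.
by rewrite mxE rmorphD mulrDl.
Qed.

Lemma rhoZ p v : rho (p *: v) = emb p * rho v.
Proof.
rewrite (rhoE (p *: v)) (rhoE v) [RHS]mulr_sumr; apply: eq_bigr => i _.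
by rewrite mxE rmorphM mulrA.
Qed.

Lemma rho0 : rho 0 = 0.
Proof. by rewrite rhoE big1 // => i _; rewrite mxE rmorph0 mul0r. Qed.

Lemma rho_sum (I : finType) (v : I -> 'rV_6) : rho (\sum_i v i) = \sum_i rho (v i).
Proof. exact: (big_morph rho rhoD rho0). Qed.

Lemma coord_rho v i j : coord (rho v)`_j i = (v 0 i)`_j.
Proof. by rewrite coef_rho; exact: (coord_sum (fun i => (v 0 i)`_j)). Qed.

Lemma rho_inj : injective rho.
Proof.
move=> v w eq_vw; apply/rowP=> i; apply/polyP=> j.
by rewrite -(coord_rho v) eq_vw coord_rho.
Qed.

Lemma rho_surj x : exists v, rho v = x.
Proof.
exists (\row_i \poly_(j < size x) coord x`_j i); apply/polyP=> j.
rewrite coef_rho -[RHS]coordK; apply: eq_bigr => i _; congr (_ *: _).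
rewrite mxE coef_poly; case: ltnP => [//|le_j].
by rewrite (nth_default 0 le_j) coord0.
Qed.

Lemma rho_coef_row s p : rho (coef_row s p) = emb p * (el s)%:P.
Proof.
apply/polyP=> j; rewrite coef_rho coef_embC scaler_sumr.
by apply: eq_bigr => i _; rewrite mxE coefZ scalerA mulrC.
Qed.

(** A complement of the ideal pulls back along rho, since a left ideal of A[z]
    is also stable under scalar polynomials. *)
Lemma direct_summand_conv_code C :
  direct_summand (rho @` C : set {poly A}^o) -> conv_code C.
Proof.
have pull (U : set {poly A}^o) : submodule U -> submodule (rho @^-1` U).
  move=> /left_idealP[U0 UD]; apply/submoduleP; split=> [|p v w Uv Uw].
    by rewrite /preimage /= rho0.
  by rewrite /preimage /= rhoD rhoZ; exact: UD Uv Uw.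
have imK : C = rho @^-1` (rho @` C).
  apply/seteqP; split=> [v Cv|v [w Cw /rho_inj<- //]].
  by exists v.
move=> [modC [W [modW [defT CW]]]]; split; first by rewrite imK; apply: pull.
exists (rho @^-1` W); split; first exact: pull.
split; apply/seteqP; split=> v //.
- move=> _; have: [set: {poly A}^o] (rho v) by [].
  rewrite defT => -[_ [u Cu <-] [y Wy def_v]]; exists u => //.
  have [w def_y] := rho_surj y; exists w; first by rewrite /= def_y.
  by apply: rho_inj; rewrite rhoD def_y.
- move=> [Cv Wv]; have: (rho @` C `&` W) (rho v) by split=> //; exists v.
  by rewrite CW /= -[X in _ = X]rho0 => /rho_inj.
- move=> ->; have: [set (0 : {poly A}^o)] 0 by [].
  rewrite -CW => -[[u Cu u0] W0]; rewrite /= rho0; split=> //.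
  by rewrite -(rho_inj (etrans u0 (esym rho0))).
Qed.

(** The idempotents of the trivial character and of the sign, whose usual
    factor 1 / |S_3| is 1 modulo 5. *)
Definition e_triv : A := el [:: 1; 1; 1; 1; 1; 1]%N.
Definition e_sign : A := el [:: 1; 4; 4; 4; 1; 1]%N.

(** Matrix units of A g2. Column 0 is minus the coefficient lists of a in the
    rows of G_mat a c, column 1 is the coefficient lists of c; the sign is
    needed for E 0 0 to be idempotent. *)
Definition E_coef : seq (seq (seq nat)) :=
  [:: [:: [:: 2; 3; 0; 2; 3; 0]; [:: 0; 0; 3; 2; 3; 2]];
      [:: [:: 0; 2; 3; 0; 2; 3]; [:: 2; 2; 0; 3; 0; 3]]]%N.

Definition E (i j : 'I_2) : A := el (nth [::] (nth [::] E_coef i) j).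

Lemma E_mul i j k l : E i j * E k l = (j == k)%:R *: E i l.
Proof.
rewrite /E; case: i => [[|[|i]] //= _]; case: j => [[|[|j]] //= ltj];
  case: k => [[|[|k]] //= ltk]; case: l => [[|[|l]] //= _];
  rewrite elM elZ; apply: el_eq; vm_compute; reflexivity.
Qed.

Lemma E_sum : E 0 0 + E 1 1 = g2.
Proof. by rewrite g2E elD; apply: el_eq. Qed.

Lemma E_neq0 : E 0 0 != 0.
Proof. exact: el_neq0. Qed.

(** The 2 x 2 matrices by which b_1, ..., b_6 act on the columns of E, namely
    the irreducible representation of degree 2. *)
Definition rep_coef : seq (seq (seq nat)) :=
  [:: [:: [:: 1; 0]; [:: 0; 1]]; [:: [:: 4; 1]; [:: 0; 1]];
      [:: [:: 0; 4]; [:: 4; 0]]; [:: [:: 1; 0]; [:: 1; 4]];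
      [:: [:: 0; 4]; [:: 1; 4]]; [:: [:: 4; 1]; [:: 4; 0]]]%N.

Definition rep (i : 'I_6) (l m : 'I_2) : 'F_5 :=
  (nth 0%N (nth [::] (nth [::] rep_coef i) l) m)%:R.

(** Since g2 = E 0 0 + E 1 1 acts as the identity matrix, left multiplication
    by b i gives the matrix of b i. *)
Lemma gelt_g2 (i : 'I_6) : gelt (b i) * g2 =
  rep i 0 0 *: E 0 0 + rep i 0 1 *: E 0 1 + (rep i 1 0 *: E 1 0 + rep i 1 1 *: E 1 1).
Proof.
rewrite g2E el_unit elM /E /rep 4!elZ 3!elD; apply: el_eq.
by case: i => [[|[|[|[|[|[|i]]]]]] // lti]; vm_compute.
Qed.

Lemma gelt_e_triv i : gelt (b i) * e_triv = e_triv.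
Proof.
rewrite el_unit elM; apply: el_eq.
by case: i => [[|[|[|[|[|[|i]]]]]] // lti]; vm_compute.
Qed.

Definition sign_coef : seq nat := [:: 1; 4; 4; 4; 1; 1]%N.

Lemma gelt_e_sign i : gelt (b i) * e_sign = (nth 0%N sign_coef i)%:R *: e_sign.
Proof.
rewrite el_unit elM elZ; apply: el_eq.
by case: i => [[|[|[|[|[|[|i]]]]]] // lti]; vm_compute.
Qed.

Lemma g1_split : g1 = e_triv + e_sign.
Proof. by rewrite g1E elD; apply: el_eq. Qed.

Lemma e_triv_idem : e_triv * e_triv = e_triv.
Proof. by rewrite elM; apply: el_eq. Qed.

Lemma e_sign_idem : e_sign * e_sign = e_sign.
Proof. by rewrite elM; apply: el_eq. Qed.

Lemma A_comm (y : A) : (forall i, gelt (b i) * y = y * gelt (b i)) ->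
  forall x, x * y = y * x.
Proof. by move=> cy x; rewrite -(coordK x); apply: span_comm. Qed.

Lemma e_triv_eigen x : exists k : 'F_5, x * e_triv = k *: e_triv.
Proof.
exists (\sum_i coord x i * 1); rewrite -{1}(coordK x); apply: span_eigen => i.
by rewrite gelt_e_triv scale1r.
Qed.

Lemma e_sign_eigen x : exists k : 'F_5, x * e_sign = k *: e_sign.
Proof.
exists (\sum_i coord x i * (nth 0%N sign_coef i)%:R).
by rewrite -{1}(coordK x); apply: span_eigen => i; apply: gelt_e_sign.
Qed.

Lemma el_comm s t :
  all (fun k => conv6 s t k == conv6 t s k %[mod 5]) (iota 0 6) ->
  el s * el t = el t * el s.
Proof.
move=> /allP chk; rewrite (elM s t) (elM t s); apply: el_eq; apply/allP=> k k6.
have := chk k k6; move: k6; rewrite mem_iota => /andP[_ k6].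
by rewrite (nth_mkseq _ _ k6) (nth_mkseq _ _ k6).
Qed.

Lemma e_triv_central x : x * e_triv = e_triv * x.
Proof.
apply: A_comm => i; rewrite el_unit; apply: el_comm.
by case: i => [[|[|[|[|[|[|i]]]]]] // lti]; vm_compute.
Qed.

Lemma g1_central x : x * g1 = g1 * x.
Proof.
apply: A_comm => i; rewrite el_unit g1E; apply: el_comm.
by case: i => [[|[|[|[|[|[|i]]]]]] // lti]; vm_compute.
Qed.

Lemma g1_idem : g1 * g1 = g1.
Proof. by rewrite g1E elM; apply: el_eq. Qed.

Lemma el0 : el [::] = 0.
Proof. by rewrite /el big1 // => i _; rewrite nth_nil scale0r. Qed.

Lemma e_triv_neq0 : e_triv != 0. Proof. exact: el_neq0. Qed.

Lemma e_sign_neq0 : e_sign != 0. Proof. exact: el_neq0. Qed.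

Lemma g2_span x : exists K : 'M['F_5]_2,
  x * (E 0 0 + E 1 1) = \sum_i \sum_j K i j *: E i j.
Proof.
rewrite E_sum; exists (\matrix_(l, m) \sum_i coord x i * rep i l m).
rewrite -{1}(coordK x); apply: span_table => i.
exact: etrans (gelt_g2 i) (esym (sum22 (rep i) E)).
Qed.

(** * The minimal codes *)

Lemma rho_image_inj (C D : set 'rV_6) : rho @` C = rho @` D -> C = D.
Proof.
have sub (X Y : set 'rV_6) : rho @` X = rho @` Y -> X `<=` Y.
  move=> XY v Xv; have: (rho @` X) (rho v) by exists v.
  by rewrite XY => -[w Yw /rho_inj<-].
by move=> CD; apply/seteqP; split; apply: sub.
Qed.

Lemma minimal_idempotent C : minimal_S3_code C ->
  exists f : {poly A},
    [/\ f * f = f, rho @` C = ideal_of f & indecomposable (ideal_of f)].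
Proof.
move=> [[_ /direct_summandP[f ff defC]] indec].
by exists f; split=> //; rewrite -defC.
Qed.

Lemma idempotent_minimal (C : set 'rV_6) (f : {poly A}) :
  f * f = f -> rho @` C = ideal_of f -> indecomposable (ideal_of f) ->
  minimal_S3_code C.
Proof.
move=> ff defC indec; have sumC : direct_summand (rho @` C : set {poly A}^o).
  by apply/direct_summandP; exists f.
by split; [split; [apply: direct_summand_conv_code|] | rewrite defC].
Qed.

Lemma indecomposable_neq0 (f : {poly A}) : indecomposable (ideal_of f) -> f != 0.
Proof.
case=> _ nz _; apply/eqP=> f0; apply: nz; apply/seteqP; split=> x /=.
  by rewrite /ideal_of /= f0 mulr0.
by move=> ->; rewrite /ideal_of /= mul0r.
Qed.

Lemma Agz_ideal g : g * g = g -> Agz g = ideal_of g%:P.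
Proof.
move=> gg; apply/seteqP; split=> p /= gp; last first.
  by move=> j; exists p`_j; rewrite -[in LHS]gp coefMC.
by apply/polyP=> j; rewrite coefMC; have [x ->] := gp j; rewrite -mulrA gg.
Qed.

Section LineCodes.
Variable s : seq nat.
Hypotheses (ee : el s * el s = el s) (e0 : el s != 0).
Hypothesis eig : forall x, exists k : 'F_5, x * el s = k *: el s.
Let G := coef_row s 1.

Lemma rho_line u : rho (u *m G) = emb (u 0 0) * (el s)%:P.
Proof.
by rewrite [u]mx11_scalar mul_scalar_mx rhoZ rho_coef_row rmorph1 mul1r mxE eqxx.
Qed.

Lemma image_line : rho @` row_span G = ideal_of (el s)%:P.
Proof.
rewrite (ideal_line ee eig); apply/seteqP; split=> [_ [_ [u _ <-] <-]|_ [p _ <-]].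
  by exists (u 0 0); rewrite ?rho_line.
exists (p%:M *m G); first by exists p%:M.
by rewrite rho_line mxE eqxx.
Qed.

Lemma line_encoder : encoder (row_span G) G.
Proof.
split=> // u v /(congr1 rho); rewrite (rho_line u) (rho_line v).
by move/(emb_inj e0) => uv; rewrite [u]mx11_scalar [v]mx11_scalar uv.
Qed.

Lemma line_minimal : minimal_S3_code (row_span G).
Proof.
apply: idempotent_minimal image_line _; first exact: polyC_mul_eq.
exact: line_indecomposable.
Qed.

(** The idempotent of the code lies in the line of el s, so it is el s. *)
Lemma line_code_eq C (f : {poly A}) : f * f = f -> rho @` C = ideal_of f ->
  indecomposable (ideal_of f) -> f * (el s)%:P = f -> C = row_span G.
Proof.
move=> ff defC /indecomposable_neq0 f0 fe; apply: rho_image_inj.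
by rewrite defC image_line (line_idempotent_unique e0 eig ff fe f0).
Qed.

Lemma line_block_code : block_code (row_span G).
Proof.
split; first by have [[]] := line_minimal.
have := encoder_has_complexity line_encoder; congr (has_complexity _ _).
apply: big1 => f _; rewrite det_mx11 !mxE alg_polyC /degree size_polyC.
by case: (_ != 0).
Qed.

End LineCodes.

Lemma G_trivE : G_triv = coef_row [:: 1; 1; 1; 1; 1; 1]%N 1.
Proof.
by apply/rowP=> j; rewrite !mxE scaler_nat; case: j => [[|[|[|[|[|[|j]]]]]] //= lt_j].
Qed.

Lemma G_signE : G_sign = coef_row [:: 1; 4; 4; 4; 1; 1]%N 1.
Proof.
by apply/rowP=> j; rewrite !mxE scaler_nat; case: j => [[|[|[|[|[|[|j]]]]]] //= lt_j].
Qed.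

(** The sign of E_coef in column 0 turns the coefficient a into - a. *)
Lemma el_G_coef (i : 'I_2) a c : emb a * (el (Gc i 0))%:P + emb c * (el (Gc i 1))%:P =
  emb (- a) * (E i 0)%:P + emb c * (E i 1)%:P.
Proof.
have [-> ->] : el (Gc i 0) = - E i 0 /\ el (Gc i 1) = E i 1.
  split; last by have [->|->] := ord2 i.
  apply/eqP; rewrite -addr_eq0 -el0 /E elD; apply/eqP; apply: el_eq.
  by have [->|->] := ord2 i; vm_compute.
congr (_ + _); exact: emb_oppC.
Qed.

Lemma rho_row_G_mat a c (i : 'I_2) : rho (row i (G_mat a c)) =
  emb (- a) * (E i 0)%:P + emb c * (E i 1)%:P.
Proof.
rewrite row_G_mat; apply: etrans (rhoD _ _) _; apply: etrans (el_G_coef i a c).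
by congr (_ + _); apply: rho_coef_row.
Qed.

(** Under Mx, the row combination u of G_mat a c is the rank one matrix with
    column u^T and row (-a, c). *)
Lemma rho_G_mat a c (u : 'rV_2) :
  rho (u *m G_mat a c) = Mx E (u^T *m row2 (- a) c).
Proof.
rewrite mulmx_sum_row rho_sum; apply: etrans (esym (Mx_row2 _ _ _ _)).
apply: eq_bigr => i _; rewrite [u^T i 0]mxE; apply: etrans (rhoZ _ _) _.
apply: etrans (emb_mulDr _ _ _ _ _).
by congr (_ * _); apply: rho_row_G_mat.
Qed.

(** A Bezout identity for a and c. *)
Lemma G_mat_right_inverse (a c : {poly 'F_5}) : coprimep a c ->
  exists z : 'cV_2, row2 (- a) c *m z = 1%:M.
Proof.
move=> /coprimep_bezout[u [v uv1]]; exists (col2 (- u) v).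
by rewrite row2_col2 mulrNN mulrC [c * v]mulrC uv1.
Qed.

Lemma G_mat_encoder a c : coprimep a c -> encoder (row_span (G_mat a c)) (G_mat a c).
Proof.
move=> /G_mat_right_inverse[z wz]; split=> // u v /(congr1 rho).
rewrite (rho_G_mat a c u) (rho_G_mat a c v) => /(Mx_inj E_mul E_neq0).
move/(congr1 (mulmx^~ z)); rewrite -!mulmxA wz !mulmx1.
exact: trmx_inj.
Qed.

Lemma image_G_mat a c (z : 'cV_2) : row2 (- a) c *m z = 1%:M ->
  rho @` row_span (G_mat a c) = ideal_of (Mx E (z *m row2 (- a) c)).
Proof.
move=> wz; rewrite (ideal_rank_one E_mul g2_span wz).
apply/seteqP; split=> [_ [_ [u _ <-] <-]|_ [v _ <-]].
  by exists u^T; rewrite ?rho_G_mat.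
by exists (v^T *m G_mat a c); [exists v^T | rewrite rho_G_mat trmxK].
Qed.

Lemma G_mat_minimal a c : coprimep a c -> minimal_S3_code (row_span (G_mat a c)).
Proof.
move=> /G_mat_right_inverse[z wz].
apply: idempotent_minimal (image_G_mat wz) _.
  exact: (rank_one_idempotent E_mul wz).
exact: (rank_one_indecomposable E_mul E_neq0 g2_span wz).
Qed.

Lemma g2_idem : g2 * g2 = g2.
Proof. exact: complement_idempotent g1_idem. Qed.

Lemma G_mat_sub a c : coprimep a c -> rho @` row_span (G_mat a c) `<=` Agz g2.
Proof.
move=> /G_mat_right_inverse[z wz]; rewrite (image_G_mat wz) (Agz_ideal g2_idem).
apply/ideal_of_sub; first exact: (rank_one_idempotent E_mul wz).
by rewrite -E_sum; exact: (Mx_unit E_mul).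
Qed.

Lemma minimal_g2 C : minimal_S3_code C -> rho @` C `<=` Agz g2 ->
  exists a c, coprimep a c /\ C = row_span (G_mat a c).
Proof.
move=> /minimal_idempotent[f [ff defC indec]].
rewrite defC (Agz_ideal g2_idem) => /(ideal_of_sub _ ff) fg2.
rewrite -E_sum in fg2.
have [z [w [wz def_f]]] := rank_one_of_indecomposable E_mul E_neq0 g2_span ff fg2 indec.
have def_w : w = row2 (- - w 0 0) (w 0 1) by rewrite opprK -row2_eta.
exists (- w 0 0), (w 0 1); split.
  apply: (@bezout_coprimep _ _ _ (- z 0 0) (z 1 0)).
  have /matrixP/(_ 0 0) := wz; rewrite !mxE sum2 mulrNN => wz1.
  by apply: etrans wz1; congr (_ + _); apply: mulrC.
have wz' : row2 (- - w 0 0) (w 0 1) *m z = 1%:M by rewrite -def_w.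
by apply: rho_image_inj; rewrite defC def_f (image_G_mat wz') -def_w.
Qed.

(** The central idempotent g1 splits no minimal code. *)
Lemma minimal_split C : minimal_S3_code C ->
  rho @` C `<=` Agz g1 \/ rho @` C `<=` Agz g2.
Proof.
move=> /minimal_idempotent[f [ff -> indec]].
rewrite (Agz_ideal g1_idem) (Agz_ideal g2_idem).
have g1P : g1%:P * g1%:P = g1%:P by exact: polyC_mul_eq g1_idem.
have [fg1|fg1] := central_idempotent_split ff indec g1P (polyC_comm g1_central).
  right; apply/ideal_of_sub => //.
  exact: mul_polyC_compl.
by left; apply/ideal_of_sub.
Qed.

(** The central idempotent e_triv splits no minimal code, and g1 = e_triv +
    e_sign. *)
Lemma minimal_g1 C : minimal_S3_code C -> rho @` C `<=` Agz g1 ->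
  C = row_span G_triv \/ C = row_span G_sign.
Proof.
move=> /minimal_idempotent[f [ff defC indec]].
rewrite defC (Agz_ideal g1_idem) => /(ideal_of_sub _ ff) fg1.
have eTP : e_triv%:P * e_triv%:P = e_triv%:P by exact: polyC_mul_eq e_triv_idem.
rewrite G_trivE G_signE.
have [feT|feT] := central_idempotent_split ff indec eTP (polyC_comm e_triv_central).
  right; apply: (line_code_eq e_sign_idem e_sign_neq0 e_sign_eigen ff defC indec).
  by rewrite g1_split in fg1; exact: mul_polyC_summand fg1 feT.
left; exact: (line_code_eq e_triv_idem e_triv_neq0 e_triv_eigen ff defC indec).
Qed.

Lemma G_triv_sub : rho @` row_span G_triv `<=` Agz g1.
Proof.
rewrite G_trivE (image_line e_triv_idem e_triv_eigen) (Agz_ideal g1_idem).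
apply/ideal_of_sub; first exact: polyC_mul_eq e_triv_idem.
by apply: polyC_mul_eq; rewrite g1E elM; apply: el_eq.
Qed.

Lemma G_sign_sub : rho @` row_span G_sign `<=` Agz g1.
Proof.
rewrite G_signE (image_line e_sign_idem e_sign_eigen) (Agz_ideal g1_idem).
apply/ideal_of_sub; first exact: polyC_mul_eq e_sign_idem.
by apply: polyC_mul_eq; rewrite g1E elM; apply: el_eq.
Qed.

Lemma triv_neq_sign : row_span G_triv <> row_span G_sign.
Proof.
move=> eq_ts; have: row_span G_triv G_triv by exists 1%:M; rewrite ?mul1mx.
rewrite eq_ts => -[u _ /rowP uG].
have := uG 1; have := uG 0; rewrite !mxE !big_ord1 !mxE /= mulr1 => -> /eqP.
rewrite mul1r -[X in _ == X]/(1%:R) -polyC1 -(rmorph_nat polyC) (inj_eq (@polyC_inj _)).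
by [].
Qed.

Theorem mainTheorem5 :
  [/\ (* every minimal code is of type (i) or of type (ii) *)
      forall C : set 'rV[{poly 'F_5}]_6, minimal_S3_code C ->
        rho @` C `<=` Agz g1 \/ rho @` C `<=` Agz g2,
      (* (i) *)
      [/\ [set C : set 'rV[{poly 'F_5}]_6 |
             minimal_S3_code C /\ rho @` C `<=` Agz g1]
            = [set row_span G_triv; row_span G_sign],
          row_span G_triv <> row_span G_sign,
          [/\ encoder (row_span G_triv) G_triv, has_rank (row_span G_triv) 1 &
              block_code (row_span G_triv)] &
          [/\ encoder (row_span G_sign) G_sign, has_rank (row_span G_sign) 1 &
              block_code (row_span G_sign)]],
      (* (ii) *)
      [set C : set 'rV[{poly 'F_5}]_6 |
         minimal_S3_code C /\ rho @` C `<=` Agz g2]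
        = [set C : set 'rV[{poly 'F_5}]_6 | exists a c : {poly 'F_5},
             coprimep a c /\ encoder C (G_mat a c)] &
      forall a c : {poly 'F_5}, coprimep a c ->
        let C := row_span (G_mat a c) in
        [/\ encoder C (G_mat a c), has_rank C 2 &
            has_complexity C (maxn (2 * degree a) (2 * degree c))]].
Proof.
have encT : encoder (row_span G_triv) G_triv.
  by rewrite G_trivE; exact: (line_encoder e_triv_neq0).
have encS : encoder (row_span G_sign) G_sign.
  by rewrite G_signE; exact: (line_encoder e_sign_neq0).
split; first exact: minimal_split.
- split; last 1 first.
  + split; [exact: encS | by exists G_sign |].
    by rewrite G_signE; exact: (line_block_code e_sign_idem e_sign_neq0 e_sign_eigen).
  + apply/seteqP; split=> [C [minC sC]|C [->|->]]; first exact: minimal_g1.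
    * split; last exact: G_triv_sub.
      by rewrite G_trivE; exact: (line_minimal e_triv_idem e_triv_neq0 e_triv_eigen).
    * split; last exact: G_sign_sub.
      by rewrite G_signE; exact: (line_minimal e_sign_idem e_sign_neq0 e_sign_eigen).
  + exact: triv_neq_sign.
  + split; [exact: encT | by exists G_triv |].
    by rewrite G_trivE; exact: (line_block_code e_triv_idem e_triv_neq0 e_triv_eigen).
- apply/seteqP; split=> [C [minC sC]|C [a [c [cop [-> _]]]]].
    have [a [c [cop ->]]] := minimal_g2 minC sC.
    by exists a, c; split=> //; exact: G_mat_encoder.
  by split; [exact: G_mat_minimal | exact: G_mat_sub].
move=> a c cop C; have encC := G_mat_encoder cop; split=> //.
  by exists (G_mat a c).
rewrite -G_mat_max_minor_degree //; exact: encoder_has_complexity encC.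
Qed.
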